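(* For any SDFS $F\subseteq\mathcal Q(\mathcal T)$: (i) $F$ is finitely consistent if and only if $E(\mathcal V)=\{D\in\overline{\mathbf D}:\mathcal V\subseteq F_D\}\neq\emptyset$ for all finite $\mathcal V\subseteq F$; (ii) $\mathrm{cl}_{\mathbf F}(F)=\bigcup_{\mathcal V\subseteq F,\ \mathcal V\text{ finite}}\ \bigcap_{D\in\overline{\mathbf D}:\ \mathcal V\subseteq F_D}F_D$; (iii) $F$ is finitely coherent if and only if $F$ is finitely consistent and $F=\bigcup_{\mathcal V\subseteq F,\ \mathcal V\text{ finite}}\ \bigcap_{D\in\overline{\mathbf D}:\ \mathcal V\subseteq F_D}F_D$.
   Context: Let $\mathcal T$ be a non-empty set (of ''things''), $\mathrm{cl}:\mathcal P(\mathcal T)\to\mathcal P(\mathcal T)$ a closure operator (extensive, monotone, idempotent), $\mathcal T_-\subseteq\mathcal T$ a set of forbidden things, $\mathcal T_+:=\mathrm{cl}(\emptyset)$, with standing assumption $\mathcal T_+\cap\mathcal T_-=\emptyset$. A coherent SDT is a $D\subseteq\mathcal T$ with $\mathrm{cl}(D)=D$ and $D\cap\mathcal T_-=\emptyset$; $\overline{\mathbf D}$ is the set of all coherent SDTs. $\mathcal Q(\mathcal T)$ is the set of finite subsets of $\mathcal T$ (including $\emptyset$). For $\mathcal V\subseteq\mathcal Q(\mathcal T)$, $\Sigma_{\mathcal V}$ is the set of maps $\sigma:\mathcal V\to\mathcal T$ with $\sigma(A)\in A$ for all $A\in\mathcal V$, and $\sigma(\mathcal V):=\{\sigma(A):A\in\mathcal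 V\}$. An SDFS is any $F\subseteq\mathcal Q(\mathcal T)$. It is finitely coherent if (F1) $\emptyset\notin F$; (F2) if $A_1\in F$ and $A_1\subseteq A_2\in\mathcal Q(\mathcal T)$ then $A_2\in F$; (F3) if $A\in F$ then $A\setminus\mathcal T_-\in F$; (F4) $\{t\}\in F$ for all $t\in\mathcal T_+$; (F5) for every non-empty finite $\mathcal V\subseteq F$ and every family $(t_\sigma)_{\sigma\in\Sigma_{\mathcal V}}$ with $t_\sigma\in\mathrm{cl}(\sigma(\mathcal V))$, $\{t_\sigma:\sigma\in\Sigma_{\mathcal V}\}\in F$. An SDFS is finitely consistent if it is included in some finitely coherent SDFS. $\mathrm{cl}_{\mathbf F}(F)$ denotes the intersection of all finitely coherent SDFSes including $F$, which is $\mathcal Q(\mathcal T)$ if there are none. For $D\subseteq\mathcal T$ let $F_D:=\{A\in\mathcal Q(\mathcal T):A\cap D\neq\emptyset\}$. For $S\subseteq\mathcal T$ let $\overline{\mathbf D}_S:=\{D\in\overline{\mathbf D}:S\cap D\neq\emptyset\}$ and $E(\mathcal V):=\bigcap_{A\in\mathcal V}\overline{\mathbf D}_A$ (with $E(\emptyset)=\overline{\mathbf D}$). An intersection over an empty family of $F_D$'s is taken to be $\mathcal Q(\mathcal T)$. *)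

(* Defs.v *)
From mathcomp Require Import all_boot all_classical.

Set Implicit Arguments.
Unset Strict Implicit.
Unset Printing Implicit Defensive.

Local Open Scope classical_set_scope.

Record closure_operator (T : Type) (cl : set T -> set T) : Prop := {
  cl_extensive : forall A, A `<=` cl A;
  cl_monotone : forall A B, A `<=` B -> cl A `<=` cl B;
  cl_idempotent : forall A, cl (cl A) = cl A }.

Definition coherent_SDTs (T : Type) (cl : set T -> set T) (Tneg : set T) :
    set (set T) :=
  [set D | cl D = D /\ D `&` Tneg = set0].

Definition finite_subsets (T : Type) : set (set T) := [set A | finite_set A].
Arguments finite_subsets : clear implicits.

(* A set V is coerced to the type of its elements, so a selection is defined
   on V only, and families indexed by [selections V] below do not depend on
   values outside V. *)
Definition selections (T : Type) (V : set (set T)) : set (V -> T) :=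
  [set s | forall A : V, val A (s A)].
Arguments selections {T} V.

Record finitely_coherent (T : Type) (cl : set T -> set T) (Tneg : set T)
    (F : set (set T)) : Prop := {
  fc_SDFS : F `<=` finite_subsets T;
  fc_F1 : ~ F set0;
  fc_F2 : forall A1 A2, F A1 -> A1 `<=` A2 -> finite_subsets T A2 -> F A2;
  fc_F3 : forall A, F A -> F (A `\` Tneg);
  fc_F4 : forall t, cl set0 t -> F [set t];
  fc_F5 : forall V : set (set T), V `<=` F -> finite_set V -> V !=set0 ->
    forall t : selections V -> T,
    (forall s : selections V, cl (range (val s)) (t s)) ->
    F (range t) }.

Definition finitely_consistent (T : Type) (cl : set T -> set T) (Tneg : set T)
    (F : set (set T)) : Prop :=
  exists2 G, finitely_coherent cl Tneg G & F `<=` G.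

(* Intersecting with [finite_subsets T] only matters when no finitely coherent
   superset of F exists. *)
Definition clF (T : Type) (cl : set T -> set T) (Tneg : set T)
    (F : set (set T)) : set (set T) :=
  finite_subsets T `&`
  \bigcap_(G in [set G | finitely_coherent cl Tneg G /\ F `<=` G]) G.

Definition SDFS_of (T : Type) (D : set T) : set (set T) :=
  [set A | finite_subsets T A /\ A `&` D !=set0].

(* The intersection of the SDFSes F_D for D in X, inside the finite subsets, so
   that the empty intersection is the set of all finite subsets. *)
Definition bigcap_SDFS_of (T : Type) (X : set (set T)) : set (set T) :=
  finite_subsets T `&` \bigcap_(D in X) SDFS_of D.

Definition SDTs_meeting (T : Type) (cl : set T -> set T) (Tneg S : set T) :
    set (set T) :=
  [set D | coherent_SDTs cl Tneg D /\ S `&` D !=set0].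

Definition events (T : Type) (cl : set T -> set T) (Tneg : set T)
    (V : set (set T)) : set (set T) :=
  coherent_SDTs cl Tneg `&` \bigcap_(A in V) SDTs_meeting cl Tneg A.

(* Main.v *)
(* Write N(F) for the union over finite V <= F of the intersections of the F_D
   with D coherent and V <= F_D. If A lies in the V-term, each selection s of V
   yields a point of cl(s(V)) that is in A when cl(s(V)) is coherent, and in
   Tneg otherwise; F5, F3 and F2 then put A in every finitely coherent superset
   of F. Conversely, when no V-term is the empty intersection, N(F) is itself
   finitely coherent: a coherent D meeting all A in a finite W provides a
   selection s of W with cl(s(W)) <= D. *)
Require Import Defs.
From mathcomp Require Import all_boot all_classical finmap.

Set Implicit Arguments.
Unset Strict Implicit.

Local Open Scope classical_set_scope.

(** Once I and J are choice types, I and B are enumerated by finite sets X and Y, and every such f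
    is [ext] of a member of the finite type [{ffun X -> Y}]. *)
Lemma finite_set_funs (I J : Type) (B : set J) :
  finite_set [set: I] -> finite_set B ->
  finite_set [set f : I -> J | forall i, B (f i)].
Proof.
elim/Pchoice: I => I; elim/Pchoice: J => J in B *.
move=> /finite_fsetP[X XE] /finite_fsetP[Y YE].
have inX (i : I) : i \in X by have : [set` X] i by rewrite -XE.
pose ext (g : {ffun X -> Y}) (i : I) : J := val (g (FSetSub (inX i))).
apply: (@sub_finite_set _ _ (range ext)); last exact/finite_image/finite_finset.
move=> f fB; have inY (i : I) : f i \in Y by have := fB i; rewrite YE.
exists [ffun x : X => FSetSub (inY (val x))] => //.
by apply/funext => i; rewrite /ext ffunE.
Qed.

Lemma finite_setT_set_type (T : Type) (A : set T) :
  finite_set A -> finite_set [set: A].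
Proof. by move=> Afin; rewrite (eq_finite_set (card_setT A)). Qed.

(** All values lie in the finite union of V. This is what makes the set of chosen consequences in F5
    finite. *)
Lemma finite_selections (T : Type) (V : set (set T)) :
  finite_set V -> V `<=` finite_subsets T -> finite_set (selections V).
Proof.
move=> Vfin Vsub; apply: (@sub_finite_set _ _
  [set s : V -> T | forall A, (\bigcup_(B in V) B) (s A)]).
  by move=> s sel A; exists (val A); [exact: set_valP | exact: sel].
by apply: finite_set_funs; [exact: finite_setT_set_type | exact: bigcup_finite].
Qed.

(** The set N(F) of the overview. *)
Definition natural_extension (T : Type) (cl : set T -> set T) (Tneg : set T)
    (F : set (set T)) : set (set T) :=
  \bigcup_(V in [set V : set (set T) | V `<=` F /\ finite_set V])
    bigcap_SDFS_of [set D | coherent_SDTs cl Tneg D /\ V `<=` SDFS_of D].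

Section NaturalExtension.
Variables (T : Type) (cl : set T -> set T) (Tneg : set T).
Hypothesis clP : closure_operator cl.
Hypothesis Tpos_Tneg : cl set0 `&` Tneg = set0.
Implicit Types (F G V : set (set T)) (A D : set T).

Lemma cl_sub_coherent A D : coherent_SDTs cl Tneg D -> A `<=` D -> cl A `<=` D.
Proof. by case=> DE _ /(cl_monotone clP); rewrite DE. Qed.

Lemma events_coherentE F V : F `<=` finite_subsets T -> V `<=` F ->
  events cl Tneg V = [set D | coherent_SDTs cl Tneg D /\ V `<=` SDFS_of D].
Proof.
move=> Ffin VF; apply/seteqP; split=> D /= [Dcoh DV]; split=> // A VA.
  by split; [exact/Ffin/VF | have [] := DV A VA].
by split=> //; have [] := DV A VA.
Qed.

Lemma sub_natural_extension F :
  F `<=` finite_subsets T -> F `<=` natural_extension cl Tneg F.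
Proof.
move=> Ffin A FA; exists [set A].
  by split; [move=> _ -> | exact: finite_set1].
by split; [exact: Ffin | move=> D [_]; apply].
Qed.

Lemma natural_extension_finite F :
  natural_extension cl Tneg F `<=` finite_subsets T.
Proof. by move=> A [V _ []]. Qed.

Lemma natural_extension_sub F G :
  finitely_coherent cl Tneg G -> F `<=` G -> natural_extension cl Tneg F `<=` G.
Proof.
move=> Gcoh FG A [V [VF Vfin] [Afin AD]].
have VG : V `<=` G := subset_trans VF FG.
(* F5 needs a non-empty V. For empty V, [cl set0] is itself coherent by [Tpos_Tneg], so A contains
   one of its points, and F4 and F2 suffice. *)
have [V0|VN0] := eqVneq V set0.
  have [] : SDFS_of (cl set0) A.
    apply: AD; split; last by rewrite V0.
    by split=> //; exact: cl_idempotent.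
  move=> _ [t [At clt]]; apply: (fc_F2 Gcoh (fc_F4 Gcoh clt)) => //.
  by move=> _ ->.
have tP (s : selections V) : exists t, cl (range (val s)) t /\ (A `|` Tneg) t.
  (* If [cl (range (val s))] avoids [Tneg], it is a coherent D that meets each B in V at s(B), so A
     meets it too. *)
  have [clN|/eqP/set0P[t [clt Nt]]] := pselect (cl (range (val s)) `&` Tneg = set0).
    have [] : SDFS_of (cl (range (val s))) A.
      apply: AD; split; first by split=> //; exact: cl_idempotent.
      move=> B VB; split; first exact: (fc_SDFS Gcoh (VG _ VB)).
      exists (val s (SigSub (mem_set VB))); split.
        exact: (set_valP s (SigSub (mem_set VB))).
      by apply: (cl_extensive clP); exact: imageT.
    by move=> _ [t [At clt]]; exists t; split=> //; left.
  by exists t; split=> //; right.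
have [t tE] := choice tP.
have Gt : G (range t).
  by apply: (fc_F5 Gcoh VG) => //; [exact/set0P | move=> s; case: (tE s)].
(* Removing [Tneg] from [range t] leaves only points of A. *)
apply: (fc_F2 Gcoh (fc_F3 Gcoh Gt)) => // _ [[s _ <-] NTt].
by case: (tE s) => _ [].
Qed.

Lemma natural_extension_coherent F :
  F `<=` finite_subsets T ->
  (forall V, V `<=` F -> finite_set V -> events cl Tneg V !=set0) ->
  finitely_coherent cl Tneg (natural_extension cl Tneg F).
Proof.
move=> Ffin EN0; split.
- exact: natural_extension_finite.
(* F1: the empty set meets no D, so it lies in a V-term only if E(V) is empty. *)
- move=> [V [VF Vfin] [_ N0]]; have [D] := EN0 V VF Vfin.
  by rewrite (events_coherentE Ffin VF) => /N0[_ [t []]].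
- move=> A1 A2 [V Vok [_ NA1]] A12 A2fin; exists V => //; split=> // D DV.
  have [_ [t [A1t Dt]]] := NA1 D DV.
  by split=> //; exists t; split=> //; exact: A12.
(* F3: a coherent D avoids [Tneg], so its common point with A survives the removal. *)
- move=> A [V Vok [Afin NA]]; exists V => //.
  split=> [|D DV]; first exact: finite_setD.
  have [_ [t [At Dt]]] := NA D DV; split; first exact: finite_setD.
  exists t; split=> //; split=> // Nt; case: DV => -[_ DN] _.
  by have : (D `&` Tneg) t by []; rewrite DN.
(* F4: the empty V works, since every coherent D includes [cl set0]. *)
- move=> t clt; exists set0; first by split=> //; exact: finite_set0.
  split=> [|D [Dcoh _]]; first exact: finite_set1.
  split; first exact: finite_set1.
  by exists t; split=> //; exact: (cl_sub_coherent Dcoh (@sub0set _ D)).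
- move=> W WN Wfin _ t tcl.
  have tfin : finite_subsets T (range t).
    apply/finite_image/finite_setT_set_type/(finite_selections Wfin).
    exact: subset_trans WN (@natural_extension_finite F).
  (* F5: each A in W has its own witness V; as W is finite, the union of these witnesses is again
     finite and serves for [range t]. *)
  have VP (A : W) : exists V, (V `<=` F /\ finite_set V) /\
      bigcap_SDFS_of [set D | coherent_SDTs cl Tneg D /\ V `<=` SDFS_of D] (val A).
    by have [V Vok NA] := WN _ (set_valP A); exists V.
  have [V VE] := choice VP.
  exists (\bigcup_A V A).
    split; first by move=> B [A _]; case: (VE A) => -[+ _] _; apply.
    apply: bigcup_finite => [|A _]; last by case: (VE A) => -[].
    exact: finite_setT_set_type.
  split=> // D [Dcoh DV]; split=> //.
  (* D fits the witness of each A, hence meets A. Points chosen there form a selection s inside D,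
     and t(s) lies in cl(s(W)), hence in D. *)
  have sP (A : W) : exists t, val A t /\ D t.
    have [_ [_ /(_ D)[|_ [u []]]]] := VE A; last by exists u.
    by split=> // B VB; apply: DV; exists A.
  have [s sE] := choice sP.
  have sel : selections W s by move=> A; case: (sE A).
  exists (t (SigSub (mem_set sel))); split; first exact: imageT.
  apply: cl_sub_coherent Dcoh _ _ (tcl _) => _ [A _ <-].
  by case: (sE A).
Qed.

Lemma finitely_consistentP F : F `<=` finite_subsets T ->
  finitely_consistent cl Tneg F <->
  (forall V, V `<=` F -> finite_set V -> events cl Tneg V !=set0).
Proof.
move=> Ffin; split=> [[G Gcoh FG] V VF Vfin|EN0]; last first.
  exists (natural_extension cl Tneg F).
    exact: natural_extension_coherent.
  exact: sub_natural_extension.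
(* If E(V) were empty, the V-term would contain every finite set, so [set0] would belong to G,
   against F1. *)
apply/set0P/eqP => E0; apply: (fc_F1 Gcoh).
apply: (natural_extension_sub Gcoh FG); exists V => //.
by rewrite -(events_coherentE Ffin VF) E0; split; first exact: finite_set0.
Qed.

Lemma clF_natural_extension F : F `<=` finite_subsets T ->
  clF cl Tneg F = natural_extension cl Tneg F.
Proof.
move=> Ffin; apply/seteqP; split=> [A [Afin AG]|A NA]; last first.
  split; first exact: natural_extension_finite NA.
  by move=> G [Gcoh FG]; exact: natural_extension_sub NA.
have [EN0|] := pselect
  (forall V, V `<=` F -> finite_set V -> events cl Tneg V !=set0).
  by apply: AG; split; [exact: natural_extension_coherent |
                        exact: sub_natural_extension].
(* An empty E(V) makes the V-term the set of all finite subsets, which contains A. *)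
move=> /existsNP[V /not_implyP[VF /not_implyP[Vfin /set0P/negP/negPn/eqP E0]]].
by exists V => //; rewrite -(events_coherentE Ffin VF) E0; split.
Qed.

(** A finitely coherent F is its own finitely coherent superset, so it includes N(F). Conversely,
    consistency makes N(F) finitely coherent, and F equals it. *)
Lemma finitely_coherentP F : F `<=` finite_subsets T ->
  finitely_coherent cl Tneg F <->
  finitely_consistent cl Tneg F /\ F = natural_extension cl Tneg F.
Proof.
move=> Ffin; split=> [Fcoh|[/(finitely_consistentP Ffin) EN0 ->]].
  split; first by exists F.
  apply/seteqP; split; first exact: sub_natural_extension.
  exact: natural_extension_sub.
exact: natural_extension_coherent.
Qed.

End NaturalExtension.

Unset Implicit Arguments.

Theorem theorem12 (T : Type) (cl : set T -> set T) (Tneg : set T)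
    (T_nonempty : [set: T] !=set0)
    (cl_closure : closure_operator cl)
    (Tpos_Tneg : cl set0 `&` Tneg = set0)
    (F : set (set T)) (F_SDFS : F `<=` finite_subsets T) :
  [/\ (forall V : set (set T), V `<=` F -> finite_set V ->
         events cl Tneg V
         = [set D | coherent_SDTs cl Tneg D /\ V `<=` SDFS_of D])
      /\ (finitely_consistent cl Tneg F <->
          (forall V : set (set T), V `<=` F -> finite_set V ->
             events cl Tneg V !=set0)),
      clF cl Tneg F
      = \bigcup_(V in [set V : set (set T) | V `<=` F /\ finite_set V])
          bigcap_SDFS_of
            [set D | coherent_SDTs cl Tneg D /\ V `<=` SDFS_of D]
    & finitely_coherent cl Tneg F <->
      finitely_consistent cl Tneg F
      /\ F = \bigcup_(V in [set V : set (set T) | V `<=` F /\ finite_set V])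
               bigcap_SDFS_of
                 [set D | coherent_SDTs cl Tneg D /\ V `<=` SDFS_of D]].
Proof.
split; first split.
- by move=> V VF _; exact: events_coherentE F_SDFS VF.
- exact: finitely_consistentP.
- exact: clF_natural_extension.
- exact: finitely_coherentP.
Qed.
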